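(* Let $\mathbb K=\mathbb R$ or $\mathbb C$ and let $f=(f^1,\dots,f^p):\mathbb K^n\to\mathbb K^p$ be a convenient real polynomial map (if $\mathbb K=\mathbb R$) or mixed polynomial map (if $\mathbb K=\mathbb C$). If $f$ is KND, then $f$ is IKND; if $f$ is SKND, then $f$ is SIKND.
   Context: Notation. $[n]=\{1,\dots,n\}$. A real polynomial map $f:\mathbb R^n\to\mathbb R^p$ has real polynomial components and $f(0)=0$. A mixed polynomial map $f:\mathbb C^n\to\mathbb C^p$ has components that are finite sums $\sum c_{\nu,\mu}x^\nu\bar x^\mu$, $c_{\nu,\mu}\in\mathbb C$, and $f(0)=0$. For a component $g$, $\mathrm{supp}(g)=\{\nu: c_\nu\ne0\}$ in the real case and $\mathrm{supp}(g)=\{\nu+\mu: c_{\nu,\mu}\neq0\}$ in the mixed case. For $A\subset\mathbb R^n$, $g_A$ is the sum of the terms of $g$ whose exponent $\nu$ (resp. $\nu+\mu$) lies in $A$. For $w\in(\mathbb Q_{>0})^n$, $d(w;g)=\min\{\langle w,\nu\rangle:\nu\in\mathrm{supp}(g)\}$ and $g_w$ is the sum of the terms of $g$ attaining this minimum; $f_w=(f^1_w,\dots,f^p_w)$. $V(f)=f^{-1}(0)$; $\Sigma(f)$ is the set of points where the real Jacobian matrix of $f$ has rank $<p$ if $\mathbb K=\mathbb R$, and rank $<2p$ if $\mathbb K=\mathbb C$ (identifying $\mathbb C=\mathbb R^2$). For $I\subset[n]$, $\mathbb K^I=\{x\in\mathbb K^n:x_i=0\ \forall i\notin I\}$ and $(\mathbb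 K^* )^I=\{x\in\mathbb K^I:x_i\ne0\ \forall i\in I\}$. Convenient, KND, SKND. $f$ is convenient if $\mathrm{supp}(f^j)\cap\mathbb R^{\{i\}}\ne\emptyset$ for all $i\in[n]$, $j\in[p]$. $f$ is KND if $\Sigma(f_w)\cap V(f_w)\cap(\mathbb K^* )^n=\emptyset$ for every $w\in(\mathbb N_{>0})^n$, and SKND if $\Sigma(f_w)\cap(\mathbb K^* )^n=\emptyset$ for every $w\in(\mathbb N_{>0})^n$. $C$-face diagrams. A $C$-face diagram is a set $D=D(J)=\{\nu\in(\mathbb R_{\ge0})^n:\min_{\ell\in J}\ell(\nu)=1\}$, with $J$ a nonempty finite set of linear forms with positive rational coefficients. For $w\in(\mathbb Q_{>0})^n$, $d(w;D)=\min_{\nu\in D}\langle w,\nu\rangle$ and $\Delta(w;D)$ is the subset of $D$ where this minimum is attained. $\mathcal P(D)\subset(\mathbb Q_{>0})^n$ consists of one weight vector $w$ for each $(n-1)$-dimensional face $\Delta(w;D)$ of $D$. A face of $D$ is a nonempty set $\Delta=\{\nu\in D:\nu_i=0\ (i\notin I_\Delta),\ \ell(\nu)=1\ (\ell\in J_\Delta)\}$ with $I_\Delta\subset[n]$, $\emptyset\ne J_\Delta\subset J$; it is inner if it is not contained in any proper coordinate subspace. For $C$-face diagrams $D_1,\dots,D_p$, $D=D_1+\dots+D_p$ denotes the union of the compact faces of the Minkowski sum of the polyhedra $D_j+(\mathbb R_{\ge0})^n$; it is again a $C$-face diagram, and each face $\Delta$ of $D$ decomposes uniquely as a Minkowski sum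 $\Delta=\Delta_1+\dots+\Delta_p$ with $\Delta_j$ a face of $D_j$. Put $f_\Delta=(f^1_{\Delta_1},\dots,f^p_{\Delta_p})$. IKND/SIKND. $f$ is IKND if there are $C$-face diagrams $D_1,\dots,D_p$ such that (a) $d(w;f^j)\ge d(w;D_j)$ for all $j$ and $w\in\mathcal P(D_j)$; and (b) for every inner face $\Delta$ of $D=D_1+\dots+D_p$ and every nonempty $I\subset[n]$ with $\Delta\cap\mathbb R^I\neq\emptyset$, $\Sigma(f_\Delta)\cap V(f_\Delta)\cap(\mathbb K^* )^I=\emptyset$. It is SIKND if moreover $\Sigma(f_\Delta)\cap(\mathbb K^* )^I=\emptyset$ for all such $\Delta,I$. *)

(* Defs.v *)
(* MathComp and MathComp-Analysis, over R : realType.  The notations of mpoly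
   clash with those of the analysis library and are not imported. *)
From HB Require Import structures.
From mathcomp Require Import all_boot all_order all_algebra.
From mathcomp Require Import all_classical reals ereal topology normedtype.
From mathcomp Require Import derive.
From mathcomp Require Import complex.
From mathcomp Require Import -(notations) mpoly.

Set Implicit Arguments.
Unset Strict Implicit.
Unset Printing Implicit Defensive.
Import Order.TTheory GRing.Theory Num.Theory.
Import numFieldNormedType.Exports.

Local Open Scope classical_set_scope.
Local Open Scope ring_scope.

Variant ground := RealField | ComplexField.

Definition scalar (R : realType) (k : ground) : fieldType :=
  match k with RealField => R | ComplexField => R[i] end.

(* Real dimension of K^n.  It is also the number of formal variables of a
   polynomial on K^n: a mixed polynomial is encoded as a polynomial in n + n
   variables, the left ones standing for x and the right ones for its complex
   conjugate, so that an exponent is a pair (nu, mu). *)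
Definition rdim (k : ground) (n : nat) : nat :=
  match k with RealField => n | ComplexField => (n + n)%N end.

Definition polynomial (R : realType) (k : ground) (n : nat) :=
  mpoly (rdim k n) (scalar R k).

Definition polymap (R : realType) (k : ground) (n p : nat) :=
  'I_p -> polynomial R k n.

(* The exponent nu (real case), resp. nu + mu (mixed case), as a point of R^n. *)
Definition exponent (R : realType) (k : ground) (n : nat) :
    multinom (rdim k n) -> 'rV[R]_n :=
  match k with
  | RealField => fun m => \row_i (m i)%:R
  | ComplexField => fun m =>
      \row_i (m (lshift n i) + m (rshift n i))%:R
  end.

Definition evalp (R : realType) (k : ground) (n : nat) :
    polynomial R k n -> 'rV[scalar R k]_n -> scalar R k :=
  match k with
  | RealField => fun g (x : 'rV[R]_n) => meval (fun i => x 0 i) g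
  | ComplexField => fun g (x : 'rV[R[i]]_n) =>
      meval (fun i => row_mx x (map_mx (@conjc R) x) 0 i) g
  end.

Definition evalmap (R : realType) (k : ground) (n p : nat)
    (f : polymap R k n p) (x : 'rV[scalar R k]_n) : 'rV[scalar R k]_p :=
  \row_j evalp (f j) x.

(* The identification of C^n with R^n x R^n = R^(n + n) by x = a + i b. *)
Definition to_real (R : realType) (k : ground) (n : nat) :
    'rV[scalar R k]_n -> 'rV[R]_(rdim k n) :=
  match k with
  | RealField => fun x => x
  | ComplexField => fun x : 'rV[R[i]]_n =>
      row_mx (map_mx (@complex.Re R) x) (map_mx (@complex.Im R) x)
  end.

Definition of_real (R : realType) (k : ground) (n : nat) :
    'rV[R]_(rdim k n) -> 'rV[scalar R k]_n :=
  match k with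
  | RealField => fun u => u
  | ComplexField => fun u : 'rV[R]_(n + n) =>
      \row_i (Complex (u 0 (lshift n i)) (u 0 (rshift n i)) : R[i])
  end.

Definition realmap (R : realType) (k : ground) (n p : nat)
    (f : polymap R k n p) (u : 'rV[R]_(rdim k n)) : 'rV[R]_(rdim k p) :=
  to_real (evalmap f (of_real u)).

Definition zeros (R : realType) (k : ground) (n p : nat)
    (f : polymap R k n p) : set 'rV[scalar R k]_n :=
  [set x | evalmap f x = 0].

Definition singular (R : realType) (k : ground) (n p : nat)
    (f : polymap R k n p) : set 'rV[scalar R k]_n :=
  [set x | (\rank ('J (realmap f) (to_real x)) < rdim k p)%N].

Definition coord_subspace (K : fieldType) (n : nat) (I : {set 'I_n}) :
    set 'rV[K]_n :=
  [set x | forall i, i \notin I -> x 0 i = 0].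

Definition torus (K : fieldType) (n : nat) (I : {set 'I_n}) : set 'rV[K]_n :=
  [set x | coord_subspace I x /\ forall i, i \in I -> x 0 i != 0].

Definition supp (R : realType) (k : ground) (n : nat) (g : polynomial R k n) :
    set 'rV[R]_n :=
  [set exponent R m | m in [set m | m \in msupp g]].

(* g_A *)
Definition restrict_poly (R : realType) (k : ground) (n : nat)
    (g : polynomial R k n) (A : set 'rV[R]_n) : polynomial R k n :=
  \sum_(m <- msupp g | `[< A (exponent R m) >])
    mcoeff m g *: mpolyX (scalar R k) m.

Definition dotr (R : realType) (n : nat) (u v : 'rV[R]_n) : R :=
  \sum_i u 0 i * v 0 i.

Definition dotq (R : realType) (n : nat) (w : 'rV[rat]_n) (v : 'rV[R]_n) : R :=
  dotr (map_mx ratr w) v.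

Definition positive_weight (n : nat) (w : 'rV[rat]_n) : Prop :=
  forall i, 0 < w 0 i.

(* d(w; g) is min_along w (supp g), equal to +oo when g = 0, and d(w; D) is
   min_along w D; in both cases the infimum of a nonempty set is attained. *)
Definition min_along (R : realType) (n : nat) (w : 'rV[rat]_n)
    (S : set 'rV[R]_n) : \bar R :=
  ereal_inf [set (dotq w v)%:E | v in S].

(* Delta(w; S) *)
Definition min_locus (R : realType) (n : nat) (w : 'rV[rat]_n)
    (S : set 'rV[R]_n) : set 'rV[R]_n :=
  [set v | S v /\ (dotq w v)%:E = min_along w S].

Definition initial_map (R : realType) (k : ground) (n p : nat)
    (f : polymap R k n p) (w : 'rV[rat]_n) : polymap R k n p :=
  fun j => restrict_poly (f j) (min_locus w (supp (f j))).

Definition convenient (R : realType) (k : ground) (n p : nat)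
    (f : polymap R k n p) : Prop :=
  forall (i : 'I_n) (j : 'I_p),
    supp (f j) `&` coord_subspace [set i]%SET !=set0.

Definition KND (R : realType) (k : ground) (n p : nat)
    (f : polymap R k n p) : Prop :=
  forall w : 'rV[nat]_n, (forall i, (0 < w 0%R i)%N) ->
    let fw := initial_map f (map_mx (fun a : nat => a%:R) w) in
    singular fw `&` zeros fw `&` torus [set: 'I_n]%SET = set0.

Definition SKND (R : realType) (k : ground) (n p : nat)
    (f : polymap R k n p) : Prop :=
  forall w : 'rV[nat]_n, (forall i, (0 < w 0%R i)%N) ->
    let fw := initial_map f (map_mx (fun a : nat => a%:R) w) in
    singular fw `&` torus [set: 'I_n]%SET = set0.

Definition orthant (R : realType) (n : nat) : set 'rV[R]_n :=
  [set v | forall i, 0 <= v 0 i].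

(* D(J); the finite set J of linear forms is given by an enumeration. *)
Definition diagram (R : realType) (n : nat) (J : seq 'rV[rat]_n) :
    set 'rV[R]_n :=
  [set v | [/\ orthant v, (forall l, l \in J -> 1 <= dotq l v)
             & exists2 l, l \in J & dotq l v = 1]].

Definition is_diagram_of (R : realType) (n : nat) (J : seq 'rV[rat]_n)
    (D : set 'rV[R]_n) : Prop :=
  [/\ J != [::], (forall l, l \in J -> positive_weight l) & D = diagram J].

Definition C_face_diagram (R : realType) (n : nat) (D : set 'rV[R]_n) : Prop :=
  exists J, is_diagram_of J D.

(* The collection of faces does not depend on the choice of J with D = D(J). *)
Definition is_face (R : realType) (n : nat) (D F : set 'rV[R]_n) : Prop :=
  F !=set0 /\
  exists J (I : {set 'I_n}) (JF : seq 'rV[rat]_n),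
    [/\ is_diagram_of J D, JF != [::], {subset JF <= J}
      & F = [set v | [/\ D v, (forall i, i \notin I -> v 0 i = 0)
                       & forall l, l \in JF -> dotq l v = 1]]].

Definition inner (R : realType) (n : nat) (F : set 'rV[R]_n) : Prop :=
  forall I : {set 'I_n}, I \proper [set: 'I_n]%SET ->
    ~ F `<=` coord_subspace I.

(* The affine hull of S has dimension d. *)
Definition has_dim (R : realType) (n : nat) (S : set 'rV[R]_n) (d : nat) :
    Prop :=
  exists v0 (A : 'M[R]_(d, n)),
    [/\ S v0, row_free A, (forall i, S (v0 + row i A))
      & forall v, S v -> (v - v0 <= A)%MS].

(* P(D): one weight is chosen for each (n-1)-dimensional face Delta(w; D). *)
Definition facet_weights (R : realType) (n : nat) (D : set 'rV[R]_n) :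
    set 'rV[rat]_n :=
  [set xget 0 [set w' | positive_weight w' /\ min_locus w' D = min_locus w D]
     | w in [set w | positive_weight w /\ has_dim (min_locus w D) n.-1]].

Definition minkowski_sum (R : realType) (n p : nat)
    (S : 'I_p -> set 'rV[R]_n) : set 'rV[R]_n :=
  [set \sum_j a j | a in [set a : 'I_p -> 'rV[R]_n | forall j, S j (a j)]].

Definition add_orthant (R : realType) (n : nat) (D : set 'rV[R]_n) :
    set 'rV[R]_n :=
  [set a + b | a in D & b in @orthant R n].

(* Faces of a polyhedron: the loci where a linear form attains its minimum. *)
Definition polyhedron_face (R : realType) (n : nat) (P F : set 'rV[R]_n) :
    Prop :=
  F !=set0 /\
  exists u : 'rV[R]_n,
    F = [set v | P v /\ forall v', P v' -> dotr u v <= dotr u v'].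

Definition diagram_sum (R : realType) (n p : nat)
    (D : 'I_p -> set 'rV[R]_n) : set 'rV[R]_n :=
  [set v | exists F, [/\ polyhedron_face
                           (minkowski_sum (fun j => add_orthant (D j))) F,
                         compact F & F v]].

(* f_Delta, in terms of the summands Delta_j of Delta *)
Definition face_map (R : realType) (k : ground) (n p : nat)
    (f : polymap R k n p) (F : 'I_p -> set 'rV[R]_n) : polymap R k n p :=
  fun j => restrict_poly (f j) (F j).

(* F = F_1 + ... + F_p is the decomposition of a face of D_1 + ... + D_p. *)
Definition face_decomposition (R : realType) (n p : nat)
    (D : 'I_p -> set 'rV[R]_n) (F : set 'rV[R]_n)
    (Fs : 'I_p -> set 'rV[R]_n) : Prop :=
  (forall j, is_face (D j) (Fs j)) /\ F = minkowski_sum Fs.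

(* Condition (a) of IKND *)
Definition diagrams_below (R : realType) (k : ground) (n p : nat)
    (f : polymap R k n p) (D : 'I_p -> set 'rV[R]_n) : Prop :=
  (forall j, C_face_diagram (D j)) /\
  forall j w, facet_weights (D j) w ->
    (min_along w (D j) <= min_along w (supp (f j)))%E.

(* Condition (b) of IKND *)
Definition inner_nondegenerate (R : realType) (k : ground) (n p : nat)
    (f : polymap R k n p) (D : 'I_p -> set 'rV[R]_n) : Prop :=
  forall F Fs (I : {set 'I_n}),
    is_face (diagram_sum D) F -> inner F -> face_decomposition D F Fs ->
    I != finset.set0 -> F `&` coord_subspace I !=set0 ->
    singular (face_map f Fs) `&` zeros (face_map f Fs) `&` torus I = set0.

Definition inner_strongly_nondegenerate (R : realType) (k : ground)
    (n p : nat) (f : polymap R k n p) (D : 'I_p -> set 'rV[R]_n) : Prop :=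
  forall F Fs (I : {set 'I_n}),
    is_face (diagram_sum D) F -> inner F -> face_decomposition D F Fs ->
    I != finset.set0 -> F `&` coord_subspace I !=set0 ->
    singular (face_map f Fs) `&` torus I = set0.

Definition IKND (R : realType) (k : ground) (n p : nat)
    (f : polymap R k n p) : Prop :=
  exists D, diagrams_below f D /\ inner_nondegenerate f D.

Definition SIKND (R : realType) (k : ground) (n p : nat)
    (f : polymap R k n p) : Prop :=
  exists D, [/\ diagrams_below f D, inner_nondegenerate f D
              & inner_strongly_nondegenerate f D].

(* Main.v *)
From mathcomp Require Import all_boot all_order all_algebra.
From mathcomp Require Import all_classical reals ereal topology normedtype.
From mathcomp Require Import derive complex.
From mathcomp Require Import -(notations) mpoly.
From mathcomp Require Import lra.
Require Import Defs.

Set Implicit Arguments.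
Unset Strict Implicit.
Unset Printing Implicit Defensive.
Import Order.TTheory GRing.Theory Num.Theory.
Import numFieldNormedType.Exports.

Local Open Scope classical_set_scope.
Local Open Scope ring_scope.

(** Take for [D j] the Newton boundary of [f j].  Let [S] be the support of a
    component.  Since [S] meets every half-axis, every form [l] with [1 <= l] on [S]
    has positive coefficients, and the Newton polyhedron is cut out of the orthant by
    the vertices of the rational polyhedron of these forms; they are finitely many,
    hence define a C-face diagram ([same_minima_newton]).  By linear programming
    ([vertex_below]) each positive weight has the same minimum on the diagram as on
    the support, and the minimising exponents lie on the diagram.

    An inner face of [diagram_sum D] involves no vanishing condition on coordinates,
    so it is where the sum of its defining forms, a positive weight [w], is minimal
    ([inner_face_weight]).  Minimal loci of Minkowski sums are sums of minimal loci
    ([min_locus_diagram_sum]), and bounded summands can be cancelled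
    ([face_decomposition_unique]); hence the summands of the face are the minimal
    loci of [w] on the [D j], and the face map is the initial map [f_w].

    It remains to pass from the torus of [K^I] to that of [K^n].  If the face meets
    [R^I], raising [w] on the coordinates outside [I] replaces each summand by its
    intersection with [R^I] ([min_locus_raise]).  The new initial map is the
    restriction of the old one to [K^I] composed with the projection onto [K^I].  So a
    singular point, or zero, of the old map in the torus of [K^I] stays one for the
    new map when its vanishing coordinates are set to [1] ([singular_project],
    [inner_face_transfer]), which the hypothesis on initial maps excludes. *)

(** * Linear forms and their minimal loci *)

Section Pairing.
Variables (F : comNzRingType) (n : nat).
Implicit Types (a : F) (u v s : 'rV[F]_n).

Definition pairing u v : F := \sum_i u 0 i * v 0 i.

Lemma pairingDl u u' v : pairing (u + u') v = pairing u v + pairing u' v.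
Proof. by rewrite -big_split; apply: eq_bigr => i _; rewrite mxE mulrDl. Qed.

Lemma pairingZl a u v : pairing (a *: u) v = a * pairing u v.
Proof. by rewrite mulr_sumr; apply: eq_bigr => i _; rewrite mxE mulrA. Qed.

Lemma pairingNl u v : pairing (- u) v = - pairing u v.
Proof. by rewrite -scaleN1r pairingZl mulN1r. Qed.

Lemma pairing_axis u s i :
  (forall k, k != i -> s 0 k = 0) -> pairing u s = u 0 i * s 0 i.
Proof.
move=> s0; rewrite /pairing (bigD1 i) //= big1 ?addr0 // => k ki.
by rewrite s0 // mulr0.
Qed.

End Pairing.

Section RationalForms.
Variables (R : realType) (n : nat).
Implicit Types (u w l : 'rV[rat]_n) (v : 'rV[R]_n).

Lemma dotqE w v : dotq w v = \sum_i ratr (w 0 i) * v 0 i.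
Proof. by apply: eq_bigr => i _; rewrite mxE. Qed.

Lemma dotqDl w w' v : dotq (w + w') v = dotq w v + dotq w' v.
Proof.
rewrite !dotqE -big_split; apply: eq_bigr => i _.
by rewrite mxE rmorphD mulrDl.
Qed.

Lemma dotqZl (a : rat) w v : dotq (a *: w) v = ratr a * dotq w v.
Proof.
by rewrite !dotqE mulr_sumr; apply: eq_bigr => i _; rewrite mxE rmorphM mulrA.
Qed.

Lemma dotqNl w v : dotq (- w) v = - dotq w v.
Proof. by rewrite -scaleN1r dotqZl rmorphN1 mulN1r. Qed.

Lemma dotqDr w v v' : dotq w (v + v') = dotq w v + dotq w v'.
Proof.
by rewrite !dotqE -big_split; apply: eq_bigr => i _; rewrite mxE mulrDr.
Qed.

Lemma dotq_sumr w (I : Type) (r : seq I) (v : I -> 'rV[R]_n) :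
  dotq w (\sum_(i <- r) v i) = \sum_(i <- r) dotq w (v i).
Proof.
elim: r => [|i r IH]; last by rewrite !big_cons dotqDr IH.
by rewrite !big_nil dotqE big1 // => i _; rewrite mxE mulr0.
Qed.

Lemma dotq_suml (r : seq 'rV[rat]_n) v :
  dotq (\sum_(l <- r) l) v = \sum_(l <- r) dotq l v.
Proof.
elim: r => [|i r IH]; last by rewrite !big_cons dotqDl IH.
by rewrite !big_nil dotqE big1 // => i _; rewrite mxE rmorph0 mul0r.
Qed.

Lemma dotq_ratr w s : dotq w (map_mx (@ratr R) s) = ratr (pairing w s).
Proof.
rewrite dotqE /pairing rmorph_sum; apply: eq_bigr => i _.
by rewrite mxE rmorphM.
Qed.

Lemma dotq_ge0 w v :
  (forall i, 0 <= w 0 i) -> orthant v -> 0 <= dotq w v.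
Proof. by move=> w0 v0; rewrite dotqE sumr_ge0 // => i _; rewrite mulr_ge0 ?ler0q. Qed.

Lemma dotq_eq0 w v : positive_weight w -> orthant v -> dotq w v = 0 -> v = 0.
Proof.
rewrite dotqE => w0 v0 wv; apply/rowP => i; rewrite mxE.
have term_ge0 k : true -> 0 <= ratr (w 0 k) * v 0 k.
  by move=> _; rewrite mulr_ge0 ?ler0q // ltW.
have /eqP := psumr_eq0P term_ge0 wv (i := i) isT.
by rewrite mulf_eq0 fmorph_eq0 gt_eqF //= => /eqP.
Qed.

(** The infimum in the definition of the minimal locus is a minimum there. *)
Lemma min_locusP w (S : set 'rV[R]_n) v :
  min_locus w S v <-> S v /\ forall v', S v' -> dotq w v <= dotq w v'.
Proof.
split=> [[Sv vmin]|[Sv vmin]]; split=> //.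
  by move=> v' Sv'; rewrite -lee_fin vmin; apply: ereal_inf_lbound; exists v'.
apply/eqP; rewrite eq_le; apply/andP; split.
  by apply/ereal_infP => _ [v' Sv' <-]; rewrite lee_fin vmin.
by apply: ereal_inf_lbound; exists v.
Qed.

Lemma min_locus_dotq w (S : set 'rV[R]_n) v v' :
  min_locus w S v -> min_locus w S v' -> dotq w v = dotq w v'.
Proof.
move=> /min_locusP[Sv vm] /min_locusP[Sv' vm'].
by apply/eqP; rewrite eq_le vm // vm'.
Qed.

Lemma continuous_dotq w : continuous (fun v => dotq w v).
Proof.
rewrite (_ : (fun v => dotq w v) =
    (fun v => \sum_i ratr (w 0 i) * v 0 i)); last first.
  by apply/funext => u; rewrite dotqE.
apply: continuous_big => [|i _]; first exact: add_continuous.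
by move=> v; apply: (@continuousM _ _ (cst _));
  [exact: cst_continuous | exact: coord_continuous].
Qed.

(** What the argument needs to know about a diagram [D] and the support [S] of a
    polynomial.  As the minimal loci have a common point, the minima agree; compactness
    is included because sums of diagrams keep compact faces only. *)
Definition same_minima (D S : set 'rV[R]_n) : Prop :=
  forall w, positive_weight w ->
    [/\ min_locus w S !=set0, min_locus w S `<=` min_locus w D
      & compact (min_locus w D)].

End RationalForms.

(** * Newton diagrams *)

Section NewtonDiagram.
Variables (n : nat) (S : seq 'rV[rat]_n).
Implicit Types (u w l s : 'rV[rat]_n).

(** These forms make up the blocking polyhedron of [S]. *)
Definition blocking l : Prop := forall s, s \in S -> 1 <= pairing l s.

Definition tight l : {set 'I_(size S)} := [set i : 'I_(size S) | pairing l S`_i == 1]%SET.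

(** The tight constraints of a vertex have full rank; stated as uniqueness of their
    solution, this follows from maximality of the tight set. *)
Definition vertex l : Prop :=
  blocking l /\ forall l', tight l \subset tight l' -> l' = l.

(** A vertex is determined by its set of tight constraints. *)
Lemma vertices_finite : exists J : seq 'rV[rat]_n, forall l, l \in J <-> vertex l.
Proof.
pose pick T := xget 0 [set l | vertex l /\ tight l = T].
pose J := [seq pick T | T <- enum {: {set 'I_(size S)} }].
exists [seq l <- J | `[<vertex l>]] => l; rewrite mem_filter.
split=> [/andP[/asboolP] //|vl]; apply/andP; split; first exact/asboolP.
apply/mapP; exists (tight l); first by rewrite mem_enum.
rewrite /pick; case: xgetP => [l' _ [vl' tl']|/(_ l)/=]; last by case.
by apply: vl'.2; rewrite tl'.
Qed.

Hypothesis S_ge0 : forall s, s \in S -> forall i, 0 <= s 0 i.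
Hypothesis S_neq0 : forall s, s \in S -> s != 0.
Hypothesis S_axes : forall i, exists2 s, s \in S &
  0 < s 0 i /\ forall k, k != i -> s 0 k = 0.

Lemma form_ge0_of_points u :
  (forall s, s \in S -> 0 <= pairing u s) -> forall i, 0 <= u 0 i.
Proof.
move=> us i; have [s sS [si sk]] := S_axes i.
by have := us s sS; rewrite (pairing_axis _ sk) pmulr_lge0.
Qed.

Lemma form_eq0_of_points u : (forall s, s \in S -> pairing u s = 0) -> u = 0.
Proof.
move=> us; apply/rowP => i; have [s sS [si sk]] := S_axes i.
have /eqP := us s sS; rewrite (pairing_axis _ sk) mulf_eq0 (gt_eqF si) orbF.
by move=> /eqP ->; rewrite mxE.
Qed.

Lemma blocking_gt0 l : blocking l -> positive_weight l.
Proof.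
move=> bl i; have [s sS [si sk]] := S_axes i.
have := lt_le_trans ltr01 (bl s sS).
by rewrite (pairing_axis _ sk) pmulr_lgt0.
Qed.

Lemma minimum_seq w : S != [::] ->
  exists2 s, s \in S & forall s', s' \in S -> pairing w s <= pairing w s'.
Proof.
elim: (S) => // s T IH _; have [->|/IH[t tT tmin]] := eqVneq T [::].
  by exists s => [|s']; rewrite ?mem_seq1 // => /eqP ->.
have [st|ts] := leP (pairing w s) (pairing w t).
  exists s => [|s']; first by rewrite mem_head.
  by rewrite inE => /predU1P[->//|/tmin]; exact: le_trans.
exists t => [|s']; first by rewrite inE tT orbT.
by rewrite inE => /predU1P[->|/tmin//]; rewrite ltW.
Qed.

Variable R : realType.
Implicit Types (v : 'rV[R]_n).

(** A form that is nonnegative on [S] is nonnegative on the orthant, because [S]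
    meets each half-axis.  So a direction along which the value at [v] decreases
    leaves the blocking polyhedron; and if the value is constant along [u], then [u]
    or [- u] leaves it because [S] spans. *)
Lemma descent_direction u v : u != 0 -> orthant v ->
  exists2 d, d = u \/ d = - u &
    dotq d v <= 0 /\ exists i : 'I_(size S), pairing d S`_i < 0.
Proof.
move=> u0 v0.
have leave d : (exists i : 'I_(size S), pairing d S`_i < 0) \/
    forall s, s \in S -> 0 <= pairing d s.
  have [/existsP H|/existsPn H] :=
    boolP [exists i : 'I_(size S), pairing d S`_i < 0]; first by left.
  right=> s sS; have sz : (index s S < size S)%N by rewrite index_mem.
  by have := H (Ordinal sz); rewrite /= nth_index // -leNgt.
have [uv|uv] := leP (dotq u v) 0.
  have [ui|us] := leave u; first by exists u; [left|].
  have uv0 : dotq u v = 0.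
    by apply/eqP; rewrite eq_le uv dotq_ge0 //; exact: form_ge0_of_points.
  exists (- u); first by right.
  split; first by rewrite dotqNl uv0 oppr0.
  have [//|nus] := leave (- u); case/eqP: u0; apply: form_eq0_of_points => s sS.
  apply/eqP; rewrite eq_le us // andbT.
  by have := nus s sS; rewrite pairingNl oppr_ge0.
exists (- u); first by right.
rewrite dotqNl oppr_le0 ltW //; split=> //.
have [//|nus] := leave (- u).
have : 0 <= dotq (- u) v by rewrite dotq_ge0 //; exact: form_ge0_of_points.
by rewrite dotqNl oppr_ge0 leNgt uv.
Qed.

(** Move from [l] in the direction [d] until the first constraint not yet tight
    becomes tight. *)
Lemma tighten l d v : blocking l -> dotq d v <= 0 ->
    (forall i, i \in tight l -> pairing d S`_i = 0) ->
    (exists i : 'I_(size S), pairing d S`_i < 0) ->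
  exists2 l', blocking l' &
    dotq l' v <= dotq l v /\ (#|tight l| < #|tight l'|)%N.
Proof.
move=> bl dv dt [i0 di0].
pose exit_time (i : 'I_(size S)) := (pairing l S`_i - 1) / - pairing d S`_i.
have [i di imin] := @arg_minP _ _ _ i0 (fun i : 'I_(size S) => pairing d S`_i < 0)
  exit_time di0.
set t := exit_time i.
have t0 : 0 <= t.
  by rewrite divr_ge0 ?oppr_ge0 ?(ltW di) // subr_ge0 bl // mem_nth.
exists (l + t *: d).
  move=> s sS; rewrite pairingDl pairingZl.
  have [ds|ds] := leP 0 (pairing d s).
    by apply: ler_wpDr; [exact: mulr_ge0 | exact: bl].
  have sz : (index s S < size S)%N by rewrite index_mem.
  have := imin (Ordinal sz); rewrite /= /exit_time /= nth_index // => /(_ ds).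
  rewrite -/(exit_time i) -/t ler_pdivlMr ?oppr_gt0 //.
  by rewrite mulrN lerBrDr addrC lerBlDr.
split.
  by rewrite dotqDl dotqZl gerDl mulr_ge0_le0 ?ler0q.
apply: proper_card; apply/properP; split.
  apply/fintype.subsetP => k kt; rewrite inE pairingDl pairingZl dt // mulr0 addr0.
  by move: kt; rewrite inE.
exists i; last by apply/negP => /dt di'; rewrite di' ltxx in di.
rewrite inE pairingDl pairingZl /t /exit_time invrN mulrN mulNr divfK ?(lt_eqF di) //.
by rewrite opprB addrC subrK.
Qed.

(** Linear programming.  Among the blocking forms with value at [v] at most that
    of [l], one with as many tight constraints as possible is a vertex, since otherwise
    it could be tightened further. *)
Lemma vertex_below l v : blocking l -> orthant v ->
  exists2 l', vertex l' & dotq l' v <= dotq l v.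
Proof.
move=> bl v0.
pose P k := `[< exists2 l', blocking l' &
                  dotq l' v <= dotq l v /\ #|tight l'| = k >].
have exP : exists k, P k by exists #|tight l|; apply/asboolP; exists l.
have ubP k : P k -> (k <= size S)%N.
  by move=> /asboolP[l' _ [_ <-]]; rewrite (leq_trans (max_card _)) ?card_ord.
case: (ex_maxnP exP ubP) => k /asboolP[l1 bl1 [l1v <-]] kmax.
exists l1 => //; split=> // l2 l12; apply/eqP; rewrite -subr_eq0.
apply/negPn/negP => u0; have [d du [dv dS]] := descent_direction u0 v0.
have dt i : i \in tight l1 -> pairing d S`_i = 0.
  move=> it; have := fintype.subsetP l12 i it; move: it; rewrite !inE.
  move=> /eqP e1 /eqP e2.
  by case: du => ->; rewrite ?pairingNl pairingDl pairingNl e1 e2 subrr ?oppr0.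
have [l3 bl3 [l3v l13]] := tighten bl1 dv dt dS.
have /kmax : P #|tight l3|.
  by apply/asboolP; exists l3 => //; split=> //; exact: le_trans l1v.
by rewrite leqNgt l13.
Qed.

Definition real_points : set 'rV[R]_n :=
  [set map_mx (@ratr R) s | s in [set s | s \in S]].

Variable J : seq 'rV[rat]_n.
Hypothesis J_vertices : forall l, l \in J <-> vertex l.

Lemma weight_gt0_on_points w s : positive_weight w -> s \in S -> 0 < pairing w s.
Proof.
move=> w0 sS; rewrite lt0r; apply/andP; split; last first.
  by apply: sumr_ge0 => i _; rewrite mulr_ge0 ?(S_ge0 sS) // ltW.
apply/eqP => ws0; have /eqP := S_neq0 sS; apply.
have := @dotq_eq0 R n w (map_mx (@ratr R) s) w0.
rewrite dotq_ratr ws0 rmorph0 => /(_ _ erefl) s0.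
apply/rowP => i; rewrite mxE; have /rowP/(_ i) : map_mx (@ratr R) s = 0.
  by apply: s0 => k; rewrite mxE ler0q (S_ge0 sS).
by rewrite !mxE => /eqP; rewrite fmorph_eq0 => /eqP.
Qed.

(** If [s] minimises [w] on [S], then [w] divided by its value at [s] is a blocking
    form, hence dominates some vertex. *)
Lemma vertex_below_weight w s v :
    positive_weight w -> s \in S ->
    (forall s', s' \in S -> pairing w s <= pairing w s') -> orthant v ->
  exists2 l, l \in J & ratr (pairing w s) * dotq l v <= dotq w v.
Proof.
move=> w0 sS smin v0; have m0 := weight_gt0_on_points w0 sS.
have bl : blocking ((pairing w s)^-1 *: w).
  by move=> s' s'S; rewrite pairingZl mulrC ler_pdivlMr // mul1r smin.
have [l /J_vertices lJ lv] := vertex_below bl v0; exists l => //.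
apply: (le_trans (ler_wpM2l _ lv)); first by rewrite ler0q ltW.
by rewrite dotqZl mulrA -rmorphM divff ?gt_eqF // rmorph1 mul1r.
Qed.

Lemma newton_polyhedron_points s :
  s \in S -> forall l, l \in J -> 1 <= dotq l (map_mx (@ratr R) s).
Proof.
by move=> sS l /J_vertices[bl _]; rewrite dotq_ratr -[1](rmorph1 (@ratr R)) ler_rat bl.
Qed.

Lemma orthant_points s : s \in S -> orthant (map_mx (@ratr R) s).
Proof. by move=> sS i; rewrite mxE ler0q (S_ge0 sS). Qed.

(** A point of the Newton polyhedron on which [w] does not exceed its minimum over [S]
    lies on the diagram automatically: the vertex below [w] takes the value [1] there. *)
Lemma min_locus_newton w s : positive_weight w -> s \in S ->
    (forall s', s' \in S -> pairing w s <= pairing w s') ->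
  min_locus w (@diagram R n J) =
    [set v | [/\ orthant v, forall l, l \in J -> 1 <= dotq l v
               & dotq w v <= ratr (pairing w s)]].
Proof.
move=> w0 sS smin; have m0 := weight_gt0_on_points w0 sS.
have m0R : 0 < ratr (pairing w s) :> R by rewrite ltr0q.
have in_diagram v : orthant v -> (forall l, l \in J -> 1 <= dotq l v) ->
    dotq w v <= ratr (pairing w s) -> @diagram R n J v.
  move=> v0 vJ vw; split=> //.
  have [l lJ lv] := vertex_below_weight w0 sS smin v0; exists l => //.
  apply/eqP; rewrite eq_le vJ // andbT -(ler_pM2l m0R) mulr1.
  exact: le_trans vw.
have sD : @diagram R n J (map_mx (@ratr R) s).
  apply: in_diagram; first exact: orthant_points.
    exact: newton_polyhedron_points.
  by rewrite dotq_ratr.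
apply/seteqP; split=> v.
  move=> /min_locusP[[v0 vJ _] vmin]; split=> //.
  by rewrite -dotq_ratr vmin.
move=> [v0 vJ vw]; apply/min_locusP; split; first exact: in_diagram.
move=> v' [v'0 v'J _]; apply: le_trans vw _.
have [l lJ] := vertex_below_weight w0 sS smin v'0.
by apply: le_trans; rewrite ler_pMr ?v'J.
Qed.

(** The slice lies in a box because the coefficients of [w] are positive. *)
Lemma compact_newton_slice w (m : R) : positive_weight w ->
  compact [set v | [/\ orthant v, forall l, l \in J -> 1 <= dotq l v
                     & dotq w v <= m]].
Proof.
move=> w0; pose B i := [set` `[0 : R, m / ratr (w 0 i)]].
apply: (@subclosed_compact _ _ [set v : 'rV[R]_n | forall i, B i (v 0 i)]).
- rewrite (_ : [set v | _] = (\bigcap_i [set v : 'rV[R]_n | 0 <= v 0 i]) `&`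
      (\bigcap_(l in [set l | l \in J]) [set v | 1 <= dotq l v]) `&`
      [set v | dotq w v <= m]); last first.
    apply/seteqP; split=> v; first by
      move=> [v0 vJ vm]; split=> //; split=> [i _|l lJ]; [exact: v0 | exact: vJ].
    by move=> [[v0 vJ] vm]; split=> // i; exact: v0.
  apply: closedI; first apply: closedI.
  + apply: closed_bigI => i _.
    by apply: preimage_closed (@closed_ge R 0) => v _; exact: coord_continuous.
  + apply: closed_bigI => l _.
    by apply: preimage_closed (@closed_ge R 1) => v _; exact: continuous_dotq.
  + by apply: preimage_closed (@closed_le R m) => v _; exact: continuous_dotq.
- by apply: rV_compact => i; exact: segment_compact.
- move=> v [v0 _ vm] i; rewrite /B /= in_itv /= v0 ler_pdivlMr ?ltr0q //.
  rewrite (le_trans _ vm) // dotqE (bigD1 i) //= mulrC lerDl sumr_ge0 // => k _.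
  by rewrite mulr_ge0 ?ler0q // ltW.
Qed.

(** The forms in [J] are positive since each half-axis carries a point of [S]. *)
Lemma same_minima_newton : S != [::] ->
  is_diagram_of J (@diagram R n J) /\ same_minima (@diagram R n J) real_points.
Proof.
move=> SN0.
pose one : 'rV[rat]_n := const_mx 1.
have one0 : positive_weight one by move=> i; rewrite mxE.
split.
  have [s sS smin] := minimum_seq one SN0.
  have [l lJ _] := vertex_below_weight one0 sS smin (orthant_points sS).
  split=> //; first by case: (J) lJ.
  by move=> l' /J_vertices[bl' _]; exact: blocking_gt0.
move=> w w0; have [s sS smin] := minimum_seq w SN0.
rewrite (min_locus_newton w0 sS smin); split.
- exists (map_mx (@ratr R) s); apply/min_locusP; split; first by exists s.
  by move=> _ [s' s'S <-]; rewrite !dotq_ratr ler_rat smin.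
- move=> _ /min_locusP[[s' s'S <-] s'min]; split.
  + exact: orthant_points.
  + exact: newton_polyhedron_points.
  + by rewrite -dotq_ratr s'min //; exists s.
- exact: compact_newton_slice.
Qed.

End NewtonDiagram.

(** * Faces of sums of diagrams *)

Section Faces.
Variables (R : realType) (n : nat).
Implicit Types (w l : 'rV[rat]_n) (v : 'rV[R]_n) (D F : set 'rV[R]_n).

Lemma positive_weight_sum (r : seq 'rV[rat]_n) :
    r != [::] -> (forall l, l \in r -> positive_weight l) ->
  positive_weight (\sum_(l <- r) l).
Proof.
case: r => // l r _ r0 i; rewrite summxE big_cons.
rewrite ltr_wpDr ?r0 ?mem_head // big_seq sumr_ge0 // => k kr.
by rewrite ltW // r0 // inE kr orbT.
Qed.

(** An inner face is cut out by equalities [dotq l v = 1] only, and the sum of those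
    forms is a positive weight that attains its minimum exactly where each of them
    does. *)
Lemma inner_face_weight D F : is_face D F -> inner F ->
  exists2 w, positive_weight w & F = min_locus w D.
Proof.
move=> [F0 [J [I [JF [[_ Jgt0 DE] JF0 JFJ FE]]]]] innF.
have IT : I = [set: 'I_n]%SET.
  apply/eqP/negPn/negP => IT; apply: (innF I).
    by rewrite finset.properEneq IT finset.subsetT.
  by rewrite FE => v [].
have Fv v : F v <-> D v /\ forall l, l \in JF -> dotq l v = 1.
  by rewrite FE; split=> [[]//|[? ?]]; split=> // i; rewrite IT finset.in_setT.
exists (\sum_(l <- JF) l).
  by apply: positive_weight_sum => // l /JFJ /Jgt0.
have D_ge1 v l : D v -> l \in JF -> 1 <= dotq l v.
  by rewrite DE => -[_ vJ _] /JFJ /vJ.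
have F_sum v : F v -> dotq (\sum_(l <- JF) l) v = \sum_(l <- JF) 1.
  move=> /Fv[_ vF]; rewrite dotq_suml big_seq [RHS]big_seq.
  by apply: eq_bigr => l /vF.
apply/seteqP; split=> v.
  move=> vF; apply/min_locusP; split; first by have [] := (Fv v).1 vF.
  move=> v' Dv'; rewrite F_sum // dotq_suml big_seq [leRHS]big_seq.
  by apply: ler_sum => l; exact: D_ge1.
move=> /min_locusP[Dv vmin]; apply/Fv; split=> // l lJF.
have [v1 Fv1] := F0.
have := vmin v1 ((Fv v1).1 Fv1).1.
rewrite (F_sum v1) // dotq_suml -subr_le0 -sumrB big_seq => le0.
have ge0 k : k \in JF -> 0 <= dotq k v - 1 by move=> kJ; rewrite subr_ge0 D_ge1.
have /eqP : \sum_(k <- JF | k \in JF) (dotq k v - 1) = 0.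
  by apply/eqP; rewrite eq_le le0 sumr_ge0.
rewrite psumr_eq0 // => /allP/(_ l lJF); rewrite lJF /= subr_eq0.
by move=> /eqP.
Qed.

(** By induction, as the image of a product of two compact sets under addition. *)
Lemma compact_minkowski_sum p (S : 'I_p -> set 'rV[R]_n) :
  (forall j, compact (S j)) -> compact (minkowski_sum S).
Proof.
elim: p S => [|p IH] S cS.
  rewrite (_ : minkowski_sum S = [set 0]); first exact: compact_set1.
  apply/seteqP; split=> v; first by move=> [a _ <-]; rewrite /= big_ord0.
  by move=> ->; exists (fun=> 0) => [[]//|]; rewrite big_ord0.
have -> : minkowski_sum S = (fun x : 'rV[R]_n * 'rV[R]_n => x.1 + x.2) @`
    (S ord0 `*` minkowski_sum (fun j => S (lift ord0 j))).
  apply/seteqP; split=> v.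
    move=> [a Sa <-]; exists (a ord0, \sum_j a (lift ord0 j)).
      by split=> //=; exists (fun j => a (lift ord0 j)).
    by rewrite /= big_ord_recl.
  move=> [[x _] [/= Sx [b Sb <-]] <-].
  exists (fun j => if unlift ord0 j is Some k then b k else x).
    by move=> j; case: unliftP => [k|] ->.
  rewrite big_ord_recl unlift_none; congr (_ + _).
  by apply: eq_bigr => j _; rewrite liftK.
apply: continuous_compact.
  by apply: continuous_subspaceT; exact: add_continuous.
by apply: compact_setX => //; apply: IH.
Qed.

Section Sum.
Variables (p : nat) (D : 'I_p -> set 'rV[R]_n).
Hypothesis D_orthant : forall j, D j `<=` @orthant R n.
Let P := minkowski_sum (fun j => add_orthant (D j)).

Lemma choose_points (S : 'I_p -> set 'rV[R]_n) :
  (forall j, S j !=set0) -> exists a, forall j, S j (a j).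
Proof. by move=> /(choice (P := fun j v => S j v))[a Sa]; exists a. Qed.

(** Each summand is at least its minimum, so a sum of points that is not larger than
    the sum of the minima is minimal termwise. *)
Lemma minimal_summands w (a b : 'I_p -> 'rV[R]_n) : 
    (forall j, min_locus w (D j) (a j)) -> (forall j, D j (b j)) ->
    dotq w (\sum_j b j) <= dotq w (\sum_j a j) ->
  forall j, min_locus w (D j) (b j).
Proof.
move=> am Db; rewrite !dotq_sumr -subr_ge0 -sumrB -oppr_le0 -sumrN => le0 j.
have ge0 k : true -> 0 <= - (dotq w (a k) - dotq w (b k)).
  by move=> _; rewrite opprB subr_ge0; have /min_locusP[_] := am k; apply.
have := psumr_eq0P ge0 _ (i := j) isT; rewrite (_ : \sum_k _ = 0); last first.
  by apply/eqP; rewrite eq_le le0 sumr_ge0.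
move=> /(_ erefl)/eqP; rewrite opprB subr_eq0 => /eqP ba.
apply/min_locusP; split=> // v' Dv'; rewrite ba.
by have /min_locusP[_] := am j; apply.
Qed.

(** A positive weight is positive on nonzero points of the orthant, so adding orthants
    to the summands does not enlarge the minimal locus. *)
Lemma minkowski_lower_bound w (a : 'I_p -> 'rV[R]_n) v : positive_weight w ->
    (forall j, min_locus w (D j) (a j)) -> P v ->
  dotq w (\sum_j a j) <= dotq w v /\
  (dotq w v <= dotq w (\sum_j a j) ->
    minkowski_sum (fun j => min_locus w (D j)) v).
Proof.
move=> w0 am [e eP <-].
have /choice[bc bcP] : forall j, exists bc : 'rV[R]_n * 'rV[R]_n,
    [/\ D j bc.1, orthant bc.2 & bc.1 + bc.2 = e j].
  by move=> j; have [b Db [c c0 <-]] := eP j; exists (b, c).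
pose b j := (bc j).1; pose c j := (bc j).2.
have Db j : D j (b j) by have [] := bcP j.
have c0 : orthant (\sum_j c j).
  by move=> i; rewrite summxE sumr_ge0 // => j _; have [_ + _] := bcP j; exact.
have eE : \sum_j e j = \sum_j b j + \sum_j c j.
  by rewrite -big_split; apply: eq_bigr => j _; have [_ _ <-] := bcP j.
have ab : dotq w (\sum_j a j) <= dotq w (\sum_j b j).
  rewrite !dotq_sumr; apply: ler_sum => j _.
  by have /min_locusP[_] := am j; apply.
have wc : 0 <= dotq w (\sum_j c j) by apply: dotq_ge0 => // i; rewrite ltW.
rewrite eE dotqDr; split; first by rewrite ler_wpDr.
move=> le; have cc : \sum_j c j = 0.
  by apply: (dotq_eq0 w0) => //; apply/eqP; rewrite eq_le wc andbT; lra.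
exists b; last by rewrite cc addr0.
by apply: minimal_summands am Db _; lra.
Qed.

(** The face of the Minkowski sum on which a positive weight is minimal is compact,
    being the sum of the compact faces of the summands; so it lies in the diagram
    sum, where it is again the minimal locus. *)
Lemma min_locus_diagram_sum w : positive_weight w ->
    (forall j, min_locus w (D j) !=set0) ->
    (forall j, compact (min_locus w (D j))) ->
  min_locus w (diagram_sum D) = minkowski_sum (fun j => min_locus w (D j)).
Proof.
move=> w0 /choose_points[a am] cD; set G := minkowski_sum (fun j => min_locus w _).
have GP : G `<=` P.
  move=> _ [b bm <-]; exists b => // j; exists (b j).
    by have /min_locusP[] := bm j.
  by exists 0; rewrite ?addr0 // => i; rewrite mxE.
have Ga b : G b -> dotq w b = dotq w (\sum_j a j).
  move=> [c cm <-]; rewrite !dotq_sumr; apply: eq_bigr => j _.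
  exact: min_locus_dotq.
have G_face : polyhedron_face P G.
  split; first by exists (\sum_j a j), a.
  exists (map_mx ratr w); apply/seteqP; split=> v.
    move=> Gv; split=> [|v' Pv']; first exact: GP.
    by rewrite -!/(dotq w _) (Ga v Gv); have [] := minkowski_lower_bound w0 am Pv'.
  move=> [Pv vmin]; have [_] := minkowski_lower_bound w0 am Pv; apply.
  by apply: vmin; apply: GP; exists a.
have GD : G `<=` diagram_sum D.
  by move=> v Gv; exists G; split=> //; exact: compact_minkowski_sum.
have DP : diagram_sum D `<=` P by move=> v [F [[_ [u ->]] _ []]].
apply/seteqP; split=> v.
  move=> /min_locusP[/DP Pv vmin]; have [_] := minkowski_lower_bound w0 am Pv.
  by apply; apply: vmin; apply: GD; exists a.
move=> Gv; apply/min_locusP; split; first exact: GD.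
by move=> v' /DP Pv'; rewrite (Ga v Gv); have [] := minkowski_lower_bound w0 am Pv'.
Qed.

(** Cancellation for Minkowski sums: replacing the [j]-th summand of a point of the
    sum by [b] and decomposing the result again raises the total value of the other
    summands by [dotq l b - c]; as these totals are bounded, that excess is not
    positive. *)
Lemma minkowski_cancel (A B : 'I_p -> set 'rV[R]_n) l j c b :
    (forall k, A k !=set0) -> (forall k, A k `<=` B k) ->
    minkowski_sum B `<=` minkowski_sum A ->
    (forall k, has_ubound [set dotq l v | v in B k]) ->
    (forall v, A j v -> dotq l v = c) -> B j b ->
  dotq l b <= c.
Proof.
move=> /choose_points[a0 Aa0] AB BA ubB Ac Bb.
have /choice[M BM] : forall k, exists M, forall v, B k v -> dotq l v <= M.
  by move=> k; have [M Mub] := ubB k; exists M => v Bv; apply: Mub; exists v.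
pose others (a : 'I_p -> 'rV[R]_n) := \sum_(k | k != j) dotq l (a k).
pose T := [set others a | a in [set a | forall k, B k (a k)]].
have T_sup : has_sup T.
  split; first by exists (others a0), a0 => // k; exact: AB.
  exists (\sum_(k | k != j) M k) => _ [a Ba <-].
  by apply: ler_sum => k _; exact: BM.
have T_shift t : T t -> T (t + (dotq l b - c)).
  move=> [a Ba <-]; pose a' k := if k == j then b else a k.
  have [|d Ad dE] := BA (\sum_k a' k).
    by exists a' => // k; rewrite /a'; case: eqP => [->|].
  exists d; first by move=> k; exact: AB.
  have : dotq l (\sum_k d k) = dotq l (\sum_k a' k) by rewrite dE.
  rewrite !dotq_sumr (bigD1 j) //= [RHS](bigD1 j) //= Ac // {1}/a' eqxx.
  rewrite (_ : \sum_(k | k != j) dotq l (a' k) = others a); last first.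
    by apply: eq_bigr => k kj; rewrite /a' (negPf kj).
  by rewrite /others; lra.
suff : sup T <= sup T - (dotq l b - c) by lra.
apply: ge_sup => [|t Tt]; first by case: T_sup.
rewrite lerBrDr; apply: ub_le_sup; first by case: T_sup.
exact: T_shift.
Qed.

(** Each [Fs j] is contained in the minimal locus of [D j].  Conversely, the equations
    that define [Fs j] in [D j] bound from above forms that are bounded from below on
    [D j] by the same value, so by cancellation they hold on the minimal locus. *)
Lemma face_decomposition_unique w (Fs : 'I_p -> set 'rV[R]_n) :
    (forall j, min_locus w (D j) !=set0) ->
    (forall j, compact (min_locus w (D j))) ->
    face_decomposition D (minkowski_sum (fun j => min_locus w (D j))) Fs ->
  forall j, Fs j = min_locus w (D j).
Proof.
move=> /choose_points[a am] cD [Fs_face sumE].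
have Fs0 k : Fs k !=set0 by have [] := Fs_face k.
have FsD k : Fs k `<=` D k.
  by have [_ [J [I [JF [_ _ _ ->]]]]] := Fs_face k; move=> v [].
have Fs_min k : Fs k `<=` min_locus w (D k).
  move=> v Fv; have [d0 Fd0] := choose_points Fs0.
  pose d i := if i == k then v else d0 i.
  have Fd i : Fs i (d i) by rewrite /d; case: eqP => [->|].
  have : minkowski_sum Fs (\sum_i d i) by exists d.
  rewrite -sumE => -[e em eE].
  have := @minimal_summands w a d am (fun i => FsD i _ (Fd i)) _ k.
  rewrite {2}/d eqxx; apply; rewrite -eE !dotq_sumr ler_sum // => i _.
  by have /min_locusP[_ +] := em i; apply; have /min_locusP[] := am i.
move=> j; apply/seteqP; split; first exact: Fs_min.
move=> b bm; have [Db _] := (min_locusP _ _ _).1 bm.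
have cancel l c : (forall v, Fs j v -> dotq l v = c) -> dotq l b <= c.
  move=> Fc; apply: (minkowski_cancel Fs0 Fs_min _ _ Fc bm).
    by rewrite sumE.
  move=> k; have cf : {within min_locus w (D k), continuous (fun v => dotq l v)}.
    by apply: continuous_subspaceT; exact: continuous_dotq.
  have /compact_bounded[M [_ MP]] := continuous_compact cf (cD k).
  exists (M + 1) => x Bx; apply: le_trans (ler_norm _) _.
  by apply: MP => //; lra.
have [_ [J [I [JF [[_ _ DE] _ JFJ FsE]]]]] := Fs_face j.
rewrite FsE; split=> // [i iI|l lJF].
  apply/eqP; rewrite eq_le (D_orthant Db) andbT.
  (* The vanishing of a coordinate is an equation for a form with value 0. *)
  have coordE v : dotq (delta_mx 0 i) v = v 0 i.
    rewrite dotqE (bigD1 i) //= big1 => [|k ki]; rewrite !mxE !eqxx.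
      by rewrite rmorph1 mul1r addr0.
    by rewrite (negPf ki) rmorph0 mul0r.
  rewrite -coordE; apply: cancel => v; rewrite FsE => -[_ /(_ i iI) + _].
  by rewrite coordE.
apply/eqP; rewrite eq_le cancel /=; last first.
  by move=> v; rewrite FsE => -[_ _]; apply.
by move: Db; rewrite DE => -[_ bJ _]; apply: bJ; exact: JFJ.
Qed.

End Sum.
End Faces.

(** * Weights and coordinate subspaces *)

Section CoordinateFaces.
Variables (R : realType) (n : nat).
Implicit Types (w : 'rV[rat]_n) (I : {set 'I_n}) (D : set 'rV[R]_n).

Definition raise_outside I w : 'rV[rat]_n := w + \row_i (i \notin I)%:R.

Lemma raise_outside_gt0 I w :
  positive_weight w -> positive_weight (raise_outside I w).
Proof. by move=> w0 i; rewrite !mxE ltr_wpDr. Qed.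

Lemma coord_subspace_summand p (a : 'I_p -> 'rV[R]_n) I j :
    (forall k, orthant (a k)) -> coord_subspace I (\sum_k a k) ->
  coord_subspace I (a j).
Proof.
move=> a0 aI i /aI; rewrite summxE => /psumr_eq0P; apply=> // k _.
exact: a0.
Qed.

(** Raising the weight outside [I] penalises exactly the points of the orthant
    off [R^I]. *)
Lemma min_locus_raise D I w : D `<=` @orthant R n ->
    min_locus w D `&` coord_subspace I !=set0 ->
  min_locus (raise_outside I w) D = min_locus w D `&` coord_subspace I.
Proof.
move=> D0 [v0 [v0m v0I]].
have /min_locusP[Dv0 v0min] := v0m.
have raiseE (v : 'rV[R]_n) : dotq (raise_outside I w) v =
    dotq w v + \sum_(i | i \notin I) v 0 i.
  rewrite dotqDl; congr (_ + _); rewrite dotqE [RHS]big_mkcond.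
  apply: eq_bigr => i _; rewrite mxE.
  by case: (i \notin I); rewrite ?rmorph1 ?mul1r ?rmorph0 ?mul0r.
have out0 (v : 'rV[R]_n) : coord_subspace I v -> \sum_(i | i \notin I) v 0 i = 0.
  by move=> vI; apply: big1 => i; exact: vI.
have out_ge0 v : D v -> 0 <= \sum_(i | i \notin I) v 0 i.
  by move=> Dv; apply: sumr_ge0 => i _; exact: D0.
apply/seteqP; split=> v.
  move=> /min_locusP[Dv vmin]; have := vmin _ Dv0.
  rewrite !raiseE (out0 v0) // addr0 => le; have ge := out_ge0 v Dv.
  have le' := v0min v Dv; split.
    by apply/min_locusP; split=> // v' Dv'; have := v0min v' Dv'; lra.
  have /psumr_eq0P H : \sum_(i | i \notin I) v 0 i = 0.
    by apply/eqP; rewrite eq_le ge andbT; lra.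
  by move=> i iI; apply: H => // k _; exact: D0.
move=> [/min_locusP[Dv vmin] vI]; apply/min_locusP; split=> // v' Dv'.
by rewrite !raiseE (out0 v) // addr0 ler_wpDr ?out_ge0 ?vmin.
Qed.

Lemma min_locus_scale (c : rat) w (S : set 'rV[R]_n) :
  0 < c -> min_locus (c *: w) S = min_locus w S.
Proof.
move=> c0; have c0R : 0 < ratr c :> R by rewrite ltr0q.
apply/seteqP; split=> v /min_locusP[Sv vmin]; apply/min_locusP; split=> // v' Sv'.
  by have := vmin v' Sv'; rewrite !dotqZl ler_pM2l.
by rewrite !dotqZl ler_pM2l ?vmin.
Qed.

(** The factor [c] is the product of the denominators of [w]. *)
Lemma natural_weight w : positive_weight w ->
  exists2 a : 'rV[nat]_n, (forall i, (0 < a 0%R i)%N) &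
    exists2 c : rat, 0 < c & map_mx (fun k : nat => k%:R) a = c *: w.
Proof.
move=> w0; pose c i := \prod_(k | k != i) denq (w 0 k).
have c0 i : 0 < c i by apply: prodr_gt0 => k _; exact: denq_gt0.
have num0 i : 0 < numq (w 0 i) by rewrite numq_gt0 w0.
exists (\row_i `|(numq (w 0 i) * c i)%R|%N).
  by move=> i; rewrite mxE absz_gt0 gt_eqF ?mulr_gt0.
exists (\prod_k denq (w 0 k))%:~R.
  by rewrite ltr0z prodr_gt0 // => k _; exact: denq_gt0.
apply/rowP => i; rewrite !mxE natr_absz gtr0_norm ?mulr_gt0 //.
by rewrite (bigD1 i) //= -/(c i) !intrM numqE -mulrA mulrC.
Qed.

End CoordinateFaces.

(** * Restriction of polynomial maps to coordinate subspaces *)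

Section PolynomialMaps.
Variables (R : realType).
Implicit Types (k : ground) (n p N : nat).

Definition coords k n : 'rV[scalar R k]_n -> 'I_(rdim k n) -> scalar R k :=
  match k with
  | RealField => fun (x : 'rV[R]_n) i => x 0 i
  | ComplexField => fun (x : 'rV[R[i]]_n) i =>
      row_mx x (map_mx (@conjc R) x) 0 i
  end.

(** The coordinate of [K^n] to which a formal variable, or a real coordinate,
    belongs. *)
Definition coord_index k n : 'I_(rdim k n) -> 'I_n :=
  match k with
  | RealField => id
  | ComplexField => fun q : 'I_(n + n) =>
      match fintype.split q with inl i => i | inr i => i end
  end.

Definition project k n (I : {set 'I_n}) (x : 'rV[scalar R k]_n) :
    'rV[scalar R k]_n :=
  \row_i if i \in I then x 0 i else 0.

Definition real_project k n (I : {set 'I_n}) (u : 'rV[R]_(rdim k n)) :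
    'rV[R]_(rdim k n) :=
  \row_q if coord_index q \in I then u 0 q else 0.

Definition monomial_at k n (x : 'rV[scalar R k]_n) (m : multinom (rdim k n)) :=
  \prod_q coords x q ^+ m q.

Lemma evalp_restrict k n (g : polynomial R k n) A x :
  evalp (restrict_poly g A) x =
    \sum_(m <- msupp g | `[< A (exponent R m) >]) mcoeff m g * monomial_at x m.
Proof.
by case: k g A x => g A x; rewrite /evalp /restrict_poly raddf_sum /=;
  apply: eq_bigr => m _; rewrite mevalZ mevalX.
Qed.

Lemma coords_project k n I (x : 'rV[scalar R k]_n) q :
  coords (project I x) q = if coord_index q \in I then coords x q else 0.
Proof.
case: k x q => x q /=; first by rewrite mxE.
by rewrite !mxE; case: split_ordP => i _; rewrite !mxE //; case: ifP; rewrite ?conjc0.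
Qed.

Lemma exponent_coord k n I (m : multinom (rdim k n)) :
  coord_subspace I (exponent R m) <->
  forall q, coord_index q \notin I -> m q = 0%N.
Proof.
case: k m => m /=.
  split=> mI i /mI; first by rewrite mxE => /eqP; rewrite pnatr_eq0 => /eqP.
  by rewrite mxE => ->.
split=> [mI q|mI i iI].
  rewrite -[q in m q](splitK q) /unsplit; case: fintype.split => i /mI;
  by rewrite mxE => /eqP; rewrite pnatr_eq0 addn_eq0 => /andP[/eqP ? /eqP].
by rewrite mxE !mI //= ?(unsplitK (inl _ i)) ?(unsplitK (inr _ i)).
Qed.

Lemma monomial_project k n I (x : 'rV[scalar R k]_n) m :
  monomial_at (project I x) m =
    if `[< coord_subspace I (exponent R m) >] then monomial_at x m else 0.
Proof.
rewrite /monomial_at; case: asboolP => [/exponent_coord mI|mI].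
  apply: eq_bigr => q _; rewrite coords_project; case: ifPn => // /mI ->.
  by rewrite !expr0.
have [q qI mq] : exists2 q, coord_index q \notin I & m q != 0%N.
  apply: contrapT => H; apply: mI; apply/exponent_coord => q qI.
  by apply/eqP/negPn/negP => mq; apply: H; exists q.
by rewrite (bigD1 q) //= coords_project (negPf qI) expr0n (negPf mq) mul0r.
Qed.

(** The terms of [g] that survive on [K^I] are those with exponent in [R^I], and they
    do not involve the other variables. *)
Lemma evalp_project k n I (g : polynomial R k n) A x :
  evalp (restrict_poly g (A `&` coord_subspace I)) x =
  evalp (restrict_poly g A) (project I x).
Proof.
rewrite !evalp_restrict big_mkcond [RHS]big_mkcond; apply: eq_bigr => m _.
rewrite monomial_project asbool_and.
by case: asboolP => //= _; case: asboolP; rewrite ?mulr0.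
Qed.

Lemma of_real_project k n I (u : 'rV[R]_(rdim k n)) :
  of_real (real_project I u) = project I (of_real u).
Proof.
case: k u => u; apply/rowP => i; rewrite !mxE //= /coord_index.
by rewrite (unsplitK (inl _ i)) (unsplitK (inr _ i)); case: ifP.
Qed.

Lemma to_real_project k n I (x : 'rV[scalar R k]_n) :
  real_project I (to_real x) = to_real (project I x).
Proof.
case: k x => x; apply/rowP => q; rewrite !mxE //= /coord_index.
by case: split_ordP => i _; rewrite !mxE; case: ifP.
Qed.

Variables (k : ground) (n p : nat).
Implicit Types (f : polymap R k n p) (A : 'I_p -> set 'rV[R]_n).

Definition cut_faces A (I : {set 'I_n}) j := A j `&` coord_subspace I.

Lemma evalmap_project f A I x :
  evalmap (face_map f (cut_faces A I)) x = evalmap (face_map f A) (project I x).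
Proof. by apply/rowP => j; rewrite !mxE evalp_project. Qed.

Lemma realmap_project f A I :
  realmap (face_map f (cut_faces A I)) =
  realmap (face_map f A) \o real_project I.
Proof.
by apply/funext => u; rewrite /= /realmap of_real_project evalmap_project.
Qed.

End PolynomialMaps.

(** * Differentiability and rank of the Jacobian *)

Section Smoothness.
Variable R : realType.
Implicit Types (k : ground) (n p N : nat).

Lemma differentiable_row N M (phi : 'rV[R]_N -> 'rV[R]_M) u :
  (forall q, differentiable (fun u => phi u 0 q : R) u) -> differentiable phi u.
Proof.
move=> dphi.
rewrite (_ : phi = \sum_q (fun u => phi u 0 q *: (delta_mx 0 q : 'rV[R]_M))).
  by apply: differentiable_sum => q; exact: differentiableZl.
by apply/funext => v; rewrite fct_sumE [LHS]row_sum_delta.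
Qed.

(** Over the complex numbers, real and imaginary parts are required to be
    differentiable in the real variables, as [realmap] identifies [C] with [R^2]; mixed
    polynomials need not be holomorphic. *)
Definition smooth k N : ('rV[R]_N -> scalar R k) -> Prop :=
  match k with
  | RealField => fun phi : 'rV[R]_N -> R => forall u, differentiable phi u
  | ComplexField => fun phi : 'rV[R]_N -> R[i] => forall u,
      differentiable (fun v => complex.Re (phi v)) u /\
      differentiable (fun v => complex.Im (phi v)) u
  end.

Lemma smooth_cst k N (c : scalar R k) : smooth (fun _ : 'rV[R]_N => c).
Proof.
case: k c => c /= u; first exact: differentiable_cst.
by split; exact: differentiable_cst.
Qed.

Lemma smoothD k N (phi psi : 'rV[R]_N -> scalar R k) :
  smooth phi -> smooth psi -> smooth (fun u => phi u + psi u).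
Proof.
case: k phi psi => phi psi /= s t u; first exact: differentiableD.
have [s1 s2] := s u; have [t1 t2] := t u.
split; [rewrite (_ : (fun v => _) =
    (fun v => complex.Re (phi v)) + (fun v => complex.Re (psi v)))
  | rewrite (_ : (fun v => _) =
    (fun v => complex.Im (phi v)) + (fun v => complex.Im (psi v)))];
  do ?exact: differentiableD;
  by apply/funext => v /=; rewrite fctE; case: (phi v) (psi v) => ? ? [].
Qed.

Lemma smoothM k N (phi psi : 'rV[R]_N -> scalar R k) :
  smooth phi -> smooth psi -> smooth (fun u => phi u * psi u).
Proof.
case: k phi psi => phi psi /= s t u; first exact: differentiableM.
have [s1 s2] := s u; have [t1 t2] := t u.
split; [rewrite (_ : (fun v => _) =
    (fun v => complex.Re (phi v)) * (fun v => complex.Re (psi v)) -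
    (fun v => complex.Im (phi v)) * (fun v => complex.Im (psi v)))
  | rewrite (_ : (fun v => _) =
    (fun v => complex.Re (phi v)) * (fun v => complex.Im (psi v)) +
    (fun v => complex.Im (phi v)) * (fun v => complex.Re (psi v)))].
- by apply: differentiableB; exact: differentiableM.
- by apply/funext => v /=; rewrite !fctE; case: (phi v) (psi v) => ? ? [].
- by apply: differentiableD; exact: differentiableM.
- by apply/funext => v /=; rewrite !fctE; case: (phi v) (psi v) => ? ? [].
Qed.

Lemma smooth_sum k N (J : Type) (r : seq J) (P : pred J)
    (phi : J -> 'rV[R]_N -> scalar R k) :
  (forall j, smooth (phi j)) -> smooth (fun u => \sum_(j <- r | P j) phi j u).
Proof.
move=> s; elim: r => [|j r IH].
  by under eq_fun do rewrite big_nil; exact: smooth_cst.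
under eq_fun do rewrite big_cons.
by case: (P j); [exact: smoothD | exact: IH].
Qed.

Lemma smooth_prod k N (J : Type) (r : seq J) (phi : J -> 'rV[R]_N -> scalar R k) :
  (forall j, smooth (phi j)) -> smooth (fun u => \prod_(j <- r) phi j u).
Proof.
move=> s; elim: r => [|j r IH].
  by under eq_fun do rewrite big_nil; exact: smooth_cst.
by under eq_fun do rewrite big_cons; exact: smoothM.
Qed.

Lemma smoothX k N (phi : 'rV[R]_N -> scalar R k) d :
  smooth phi -> smooth (fun u => phi u ^+ d).
Proof.
move=> s; elim: d => [|d IH]; first by under eq_fun do rewrite expr0; exact: smooth_cst.
by under eq_fun do rewrite exprS; exact: smoothM.
Qed.

Lemma smooth_coords k n q :
  smooth (fun u : 'rV[R]_(rdim k n) => coords (of_real u) q).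
Proof.
case: k q => q /= u; first exact: differentiable_coord.
case: (split_ordP q) => i ->.
  split; [under eq_fun do rewrite row_mxEl mxE /=
         |under eq_fun do rewrite row_mxEl mxE /=]; exact: differentiable_coord.
split; [under eq_fun do rewrite row_mxEr !mxE /=
       |under eq_fun do rewrite row_mxEr !mxE /=]; first exact: differentiable_coord.
by apply: differentiableN; exact: differentiable_coord.
Qed.

Lemma evalpE k n (g : polynomial R k n) x :
  evalp g x = \sum_(m <- msupp g) mcoeff m g * monomial_at x m.
Proof. by case: k g x => g x; rewrite /evalp mevalE. Qed.

Lemma differentiable_realmap k n p (f : polymap R k n p) u :
  differentiable (realmap f) u.
Proof.
have smooth_f j : smooth (fun u : 'rV[R]_(rdim k n) => evalp (f j) (of_real u)).
  under eq_fun do rewrite evalpE.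
  apply: smooth_sum => m; apply: smoothM; first exact: smooth_cst.
  by apply: smooth_prod => q; apply: smoothX; exact: smooth_coords.
apply: differentiable_row => q.
case: k f u q smooth_f => f u q /= smooth_f.
  by under eq_fun do rewrite mxE; exact: smooth_f.
case: (split_ordP q) => j ->; have [dRe dIm] := smooth_f j u.
  by under eq_fun do rewrite /realmap /to_real row_mxEl !mxE.
by under eq_fun do rewrite /realmap /to_real row_mxEr !mxE.
Qed.

Lemma differentiable_real_project k n (I : {set 'I_n}) u :
  differentiable (@real_project R k n I) u.
Proof.
apply: differentiable_row => q; under eq_fun do rewrite mxE.
by case: (_ \in I); [exact: differentiable_coord | exact: differentiable_cst].
Qed.

Lemma jacobian_comp N M L (g : 'rV[R]_N -> 'rV[R]_M) (h : 'rV[R]_M -> 'rV[R]_L) u :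
    differentiable g u -> differentiable h (g u) ->
  'J (h \o g) u = 'J g u *m 'J h (g u).
Proof.
move=> dg dh; apply/row_matrixP => i; rewrite !rowE mulmxA !mul_rV_lin1.
by rewrite diff_comp.
Qed.

(** The map with cut faces is the original one precomposed with the projection to
    [K^I], so by the chain rule its Jacobian has no larger rank. *)
Lemma singular_project k n p (f : polymap R k n p) A I x y :
    project I y = x ->
  singular (face_map f A) x -> singular (face_map f (cut_faces A I)) y.
Proof.
move=> <-; rewrite /singular /= realmap_project => rk.
rewrite jacobian_comp; last 2 first.
- exact: differentiable_real_project.
- exact: differentiable_realmap.
rewrite to_real_project; apply: leq_ltn_trans rk; exact: mxrankM_maxr.
Qed.

End Smoothness.

(** * Newton diagrams of convenient polynomials *)

(** Rational coordinates keep the blocking forms rational, as diagrams require. *)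
Definition rat_exponent (k : ground) (n : nat) :
    multinom (rdim k n) -> 'rV[rat]_n :=
  match k with
  | RealField => fun m => \row_i (m i)%:R
  | ComplexField => fun m => \row_i (m (lshift n i) + m (rshift n i))%:R
  end.

Section Supports.
Variables (R : realType) (k : ground) (n : nat).
Implicit Types (g : polynomial R k n) (m : multinom (rdim k n)).

Lemma exponentE m : exponent R m = map_mx ratr (rat_exponent m).
Proof.
by rewrite /rat_exponent; case: k m => m; apply/rowP => i; rewrite !mxE ratr_nat.
Qed.

Lemma rat_exponent_ge0 m i : 0 <= rat_exponent m 0 i.
Proof. by rewrite /rat_exponent; case: k m => m; rewrite mxE ler0n. Qed.

Lemma suppE g : supp g = @real_points n [seq rat_exponent m | m <- msupp g] R.
Proof.
apply/seteqP; split=> [_ [m mg <-]|_ [_ /mapP[m mg ->] <-]].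
  by exists (rat_exponent m); [exact: map_f | rewrite exponentE].
by exists m => //; rewrite exponentE.
Qed.

Lemma monomial_at0 m :
  monomial_at (0 : 'rV[scalar R k]_n) m = (rat_exponent m == 0)%:R.
Proof.
have -> : 0 = project finset.set0 (0 : 'rV[scalar R k]_n).
  by apply/rowP => i; rewrite !mxE; case: ifP.
rewrite monomial_project; case: asboolP => [mI|mI]; last first.
  case: eqP => // m0; case: mI => i _.
  by rewrite exponentE m0 !mxE rmorph0.
have m0 := (exponent_coord R finset.set0 m).1 mI.
rewrite (_ : rat_exponent m = 0) ?eqxx; last first.
  apply/rowP => i; rewrite mxE; have := mI i.
  rewrite exponentE mxE finset.in_set0 => /(_ isT)/eqP.
  by rewrite fmorph_eq0 => /eqP.
by rewrite /monomial_at big1 // => q _; rewrite m0 ?expr0 ?finset.in_set0.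
Qed.

(** The only monomial with zero exponent is the constant one, and its coefficient is
    the value of [g] at the origin. *)
Lemma rat_exponent_neq0 g m :
  evalp g 0 = 0 -> m \in msupp g -> rat_exponent m != 0.
Proof.
move=> g0 mg; apply/eqP => m0.
have := g0; rewrite evalpE (bigD1_seq m) ?msupp_uniq //= monomial_at0 m0 eqxx.
rewrite mulr1 big1 ?addr0 => [/eqP|m' m'm].
  by rewrite mcoeff_eq0 mg.
rewrite monomial_at0; case: eqP => [m'0|]; last by rewrite mulr0.
have zero m1 : rat_exponent m1 = 0 -> forall q, m1 q = 0%N.
  move=> m10 q; apply: ((exponent_coord R finset.set0 m1).1 _).
    by move=> i _; rewrite exponentE m10 !mxE rmorph0.
  by rewrite finset.in_set0.
by case/eqP: m'm; apply/mnmP => q; rewrite !zero.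
Qed.

(** The index [i0] excludes dimension zero, where the zero polynomial has empty
    support. *)
Lemma newton_diagram g (i0 : 'I_n) : evalp g 0 = 0 ->
    (forall i, supp g `&` coord_subspace [set i]%SET !=set0) ->
  exists D, [/\ C_face_diagram D, D `<=` @orthant R n & same_minima D (supp g)].
Proof.
move=> g0 conv; pose S := [seq rat_exponent m | m <- msupp g].
have S_ge0 s : s \in S -> forall i, 0 <= s 0 i.
  by move=> /mapP[m _ ->] i; exact: rat_exponent_ge0.
have S_neq0 s : s \in S -> s != 0.
  by move=> /mapP[m mg ->]; exact: rat_exponent_neq0 mg.
have S_axes i : exists2 s, s \in S & 0 < s 0 i /\ forall l, l != i -> s 0 l = 0.
  have [_ [[m mg <-] mi]] := conv i.
  have m_off l : l != i -> rat_exponent m 0 l = 0.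
    move=> li; have := mi l; rewrite exponentE mxE finset.in_set1 => /(_ li)/eqP.
    by rewrite fmorph_eq0 => /eqP.
  exists (rat_exponent m); [exact: map_f | split=> //].
  rewrite lt0r rat_exponent_ge0 andbT; apply/eqP => mi0.
  case/eqP: (rat_exponent_neq0 g0 mg); apply/rowP => l; rewrite mxE.
  by have [->|/m_off] := eqVneq l i.
have [J JS] := vertices_finite S.
have SN0 : S != [::] by have [s] := S_axes i0; case: (S).
have [JD DS] := same_minima_newton S_ge0 S_neq0 S_axes R JS SN0.
by exists (diagram J); split; [exists J | move=> v [] | rewrite suppE].
Qed.

Lemma min_locus_supp (D S : set 'rV[R]_n) w v : same_minima D S ->
  positive_weight w -> S v -> min_locus w S v <-> min_locus w D v.
Proof.
move=> DS w0 Sv; have [[s sm] SD _] := DS w w0; split; first exact: SD.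
move=> vD; apply/min_locusP; split=> // v' Sv'.
by rewrite (min_locus_dotq vD (SD _ sm)); have /min_locusP[_] := sm; apply.
Qed.

Lemma min_along_same_minima (D S : set 'rV[R]_n) w : same_minima D S ->
  positive_weight w -> min_along w D = min_along w S.
Proof.
by move=> DS w0; have [[s sm] /(_ _ sm)[_ <-] _] := DS w w0; case: sm.
Qed.

Lemma facet_weights_gt0 (D : set 'rV[R]_n) w :
  facet_weights D w -> positive_weight w.
Proof.
by move=> [w1 [w10 _] <-]; case: xgetP => [w' _ []//|/(_ w1)[]].
Qed.

End Supports.

(** * Transfer to initial maps *)

Section InnerFaces.
Variables (R : realType) (k : ground) (n p : nat) (f : polymap R k n p).
Variable D : 'I_p -> set 'rV[R]_n.
Hypothesis D_orthant : forall j, D j `<=` @orthant R n.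
Hypothesis D_supp : forall j, same_minima (D j) (supp (f j)).

Lemma initial_mapE w : positive_weight w ->
  initial_map f w = face_map f (fun j => min_locus w (D j)).
Proof.
move=> w0; apply/funext => j; rewrite /initial_map /face_map /restrict_poly.
rewrite big_seq_cond [RHS]big_seq_cond; apply: eq_bigl => m.
have [mg|//] := boolP (m \in msupp (f j)); congr (_ && _).
by apply: asbool_equiv_eq; apply: (min_locus_supp (D_supp j)) => //; exists m.
Qed.

(** A point vanishing off [I] is moved into the torus by setting its vanishing
    coordinates to one; there the face map turns into the initial map of a weight raised outside
    [I]. *)
Lemma inner_face_transfer F Fs (I : {set 'I_n}) x :
    is_face (diagram_sum D) F -> inner F -> face_decomposition D F Fs ->
    F `&` coord_subspace I !=set0 ->
    torus I x -> singular (face_map f Fs) x ->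
  exists (a : 'rV[nat]_n) y, let fa := initial_map f (map_mx (fun c : nat => c%:R) a) in
    [/\ forall i, (0 < a 0%R i)%N, torus [set: 'I_n]%SET y, singular fa y
      & zeros (face_map f Fs) x -> zeros fa y].
Proof.
move=> F_face F_inner F_dec FI [x_off x_on] x_sing.
have [w w0 FE] := inner_face_weight F_face F_inner.
have D_min j : min_locus w (D j) !=set0.
  by have [[v vm] SD _] := D_supp j w0; exists v; exact: SD.
have D_compact j : compact (min_locus w (D j)) by have [] := D_supp j w0.
have F_sum : F = minkowski_sum (fun j => min_locus w (D j)).
  by rewrite FE; exact: min_locus_diagram_sum.
have FsE : Fs = fun j => min_locus w (D j).
  by apply/funext; apply: face_decomposition_unique => //; rewrite -F_sum.
have FsI j : min_locus w (D j) `&` coord_subspace I !=set0.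
  have [v [vF vI]] := FI; move: vF; rewrite F_sum => -[a am aE]; exists (a j); split=> //.
  apply: (@coord_subspace_summand _ _ _ a) => [l|]; last by rewrite aE.
  by apply: (D_orthant (j := l)); have /min_locusP[] := am l.
have w'0 := raise_outside_gt0 I w0.
have [a a0 [c c0 aE]] := natural_weight w'0.
pose y : 'rV[scalar R k]_n := \row_i if i \in I then x 0 i else 1.
have yx : project I y = x.
  by apply/rowP => i; rewrite !mxE; case: (boolP (i \in I)) => [//|/x_off ->].
have fa : initial_map f (map_mx (fun c : nat => c%:R) a) =
    face_map f (cut_faces Fs I).
  rewrite aE initial_mapE => [|i]; last by rewrite mxE mulr_gt0.
  congr face_map; apply/funext => j.
  by rewrite min_locus_scale // min_locus_raise // FsE.
exists a, y; rewrite fa; split; first exact: a0.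
- split=> i; first by rewrite finset.in_setT.
  by rewrite mxE; case: ifPn => [/x_on//|_]; rewrite oner_neq0.
- exact: singular_project yx x_sing.
- by rewrite /zeros /= evalmap_project yx.
Qed.

End InnerFaces.

Theorem proposition2p5 (R : realType) (k : ground) (n p : nat)
    (f : polymap R k n p)
    (f_at_0 : evalmap f 0 = 0)
    (f_convenient : convenient f) :
  (KND f -> IKND f) /\ (SKND f -> SIKND f).
Proof.
suff [D [D_below D_orthant D_supp]] : exists D, [/\ diagrams_below f D,
    forall j, D j `<=` @orthant R n
  & (0 < n)%N -> forall j, same_minima (D j) (supp (f j))].
  have ind (I : {set 'I_n}) : I != finset.set0 -> (0 < n)%N.
    by move=> /finset.set0Pn[[i i_n] _]; apply: leq_trans i_n.
  have KND_inner : KND f -> inner_nondegenerate f D.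
    move=> knd F Fs I F_face F_inner F_dec /ind/D_supp DS FI.
    apply/seteqP; split=> // x [[x_sing x_zero] xI].
    have [a [y [a0 yT y_sing y_zero]]] :=
      inner_face_transfer D_orthant DS F_face F_inner F_dec FI xI x_sing.
    have /seteqP[/(_ y) empty _] := knd a a0.
    by case: empty; split; [split; [exact: y_sing | exact: y_zero] | exact: yT].
  have SKND_inner : SKND f -> inner_strongly_nondegenerate f D.
    move=> sknd F Fs I F_face F_inner F_dec /ind/D_supp DS FI.
    apply/seteqP; split=> // x [x_sing xI].
    have [a [y [a0 yT y_sing _]]] :=
      inner_face_transfer D_orthant DS F_face F_inner F_dec FI xI x_sing.
    have /seteqP[/(_ y) empty _] := sknd a a0.
    by case: empty; split; [exact: y_sing | exact: yT].
  split=> [knd|sknd]; first by exists D; split=> //; exact: KND_inner.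
  exists D; split=> //; last exact: SKND_inner.
  apply: KND_inner => a a0 /=; apply/seteqP; split=> // y [[y_sing _] yT].
  have /seteqP[/(_ y) empty _] := sknd a a0.
  by case: empty; split; [exact: y_sing | exact: yT].
(* In dimension zero there is no nonempty [I]; the empty diagram has no facets. *)
case: n f f_at_0 f_convenient => [|n'] f0 f0_at_0 f0_conv.
  exists (fun=> diagram [:: 0]); split=> [|j v []//|//]; split=> j.
    by exists [:: 0]; split=> // l _ [].
  move=> w [w1 [_ [v [A [[[_ _ [l _ lv]] _] _ _ _]]]] _].
  by move/eqP: lv; rewrite dotqE big_ord0 eq_sym oner_eq0.
have /choice[D DP] : forall j, exists D, [/\ C_face_diagram D,
    D `<=` @orthant R n'.+1 & same_minima D (supp (f0 j))].
  move=> j; apply: (newton_diagram ord0) => [|i]; last exact: f0_conv.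
  by have /rowP/(_ j) := f0_at_0; rewrite !mxE.
exists D; split=> [|j|_ j]; [split=> j | by case: (DP j) | by case: (DP j)].
  by case: (DP j).
move=> w /facet_weights_gt0 w0; have [_ _ DS] := DP j.
by rewrite (min_along_same_minima DS w0).
Qed.
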